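(* Let $n\geqslant 0$ be an integer, let $I^n\subset\mathbb{R}^n$ be a closed cube of real dimension $n$, let $A$ be an abelian group, and let $\mathcal{A}$ be a locally constant sheaf of abelian groups with value $A$ defined in a neighborhood of $I^n$ in $\mathbb{R}^n$. Then $$H^p(I^n,\mathcal{A})=0$$ for every integer $p>0$.
   Context: A closed cube of real dimension $n$ is a subset of $\mathbb{R}^n$ of the form $I^n=\prod_{i=1}^n[a_i,b_i]=\{x\in\mathbb{R}^n: a_i\leqslant x_i\leqslant b_i,\ 1\leqslant i\leqslant n\}$, where $a_i<b_i$ are finite real numbers for each $i$; for $n=0$, $I^0$ is a point. A locally constant sheaf with value $A$ is a sheaf of abelian groups such that every point has an open neighborhood on which the sheaf is isomorphic to the constant sheaf associated with $A$. $H^p(I^n,\mathcal{A})$ denotes the sheaf cohomology of the topological space $I^n$ with coefficients in the restriction $\mathcal{A}|_{I^n}$ (inverse image of $\mathcal{A}$ under the inclusion of $I^n$). *)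

(* Defs.v *)
From HB Require Import structures.
From mathcomp Require Import all_boot all_order all_algebra.
From mathcomp Require Import generic_quotient ring_quotient.
From mathcomp Require Import all_classical all_reals topology normedtype.

Set Implicit Arguments.
Unset Strict Implicit.
Unset Printing Implicit Defensive.

Import GRing.Theory.
Import numFieldNormedType.Exports.

Local Open Scope classical_set_scope.
Local Open Scope ring_scope.
Local Open Scope quotient_scope.

Definition incl {T : Type} {A B : set T} (AB : A `<=` B) (x : A) : B :=
  exist _ (\val x) (mem_set (AB _ (set_mem (valP x)))).

Lemma incl_continuous (X : topologicalType) (A B : set X) (AB : A `<=` B) :
  continuous (incl AB).
Proof.
by apply/continuousP => _ [V oV <-]; exists V.
Qed.

HB.instance Definition _ (X : topologicalType) (A B : set X) (AB : A `<=` B) :=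
  isContinuous.Build A B (incl AB) (@incl_continuous X A B AB).

HB.instance Definition _ (X : topologicalType) (A : set X) :=
  isContinuous.Build A X (\val : A -> X) (@initial_continuous A X \val).

Section Opens.
Variable X : topologicalType.

Definition opens := set_type (@open X).

Definition oset (U : opens) : set X := \val U.
Coercion oset : opens >-> set.

Lemma oset_open (U : opens) : open (U : set X).
Proof. exact: set_mem (valP U). Qed.

Definition oT : opens := exist _ setT (mem_set openT).

Definition oI (U V : opens) : opens :=
  exist _ ((U : set X) `&` V) (mem_set (openI (oset_open U) (oset_open V))).

Lemma oIl (U V : opens) : oI U V `<=` U. Proof. exact: subIsetl. Qed.
Lemma oIr (U V : opens) : oI U V `<=` V. Proof. exact: subIsetr. Qed.

End Opens.
Arguments oT {X}.

Record presheaf (X : topologicalType) := Presheaf {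
  sections :> opens X -> zmodType;
  res : forall U V : opens X, V `<=` U -> {additive sections U -> sections V};
  res_id : forall (U : opens X) (UU : U `<=` U) (s : sections U), res UU s = s;
  res_comp : forall (U V W : opens X) (VU : V `<=` U) (WV : W `<=` V)
    (WU : W `<=` U) (s : sections U), res WV (res VU s) = res WU s
}.
Arguments res {X} F {U V} VU : rename.

Definition is_sheaf (X : topologicalType) (F : presheaf X) : Prop :=
  forall (U : opens X) (I : Type) (V : I -> opens X)
    (VU : forall i, V i `<=` U), U `<=` \bigcup_i (V i : set X) ->
  (forall s t : F U,
      (forall i, res F (VU i) s = res F (VU i) t) -> s = t) /\
  (forall s : (forall i, F (V i)),
      (forall i j, res F (@oIl X (V i) (V j)) (s i)
                   = res F (@oIr X (V i) (V j)) (s j)) ->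
      exists t : F U, forall i, res F (VU i) t = s i).

Record sheaf (X : topologicalType) := Sheaf {
  presheaf_of :> presheaf X;
  sheafP : is_sheaf presheaf_of
}.

Record sheaf_hom (X : topologicalType) (F G : presheaf X) := SheafHom {
  hom_fun :> forall U : opens X, {additive F U -> G U};
  hom_nat : forall (U V : opens X) (VU : V `<=` U) (s : F U),
    hom_fun V (res F VU s) = res G VU (hom_fun U s)
}.

Definition isomorphic (X : topologicalType) (F G : presheaf X) : Prop :=
  exists (f : sheaf_hom F G) (g : sheaf_hom G F),
    forall U, cancel (f U) (g U) /\ cancel (g U) (f U).

Section Stalk.
Variables (X : topologicalType) (F : presheaf X) (x : X).

Definition pregerm := {U : {U : opens X | x \in oset U} & F (\val U)}.

Definition germ_equiv (s t : pregerm) : bool :=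
  `[< exists (W : opens X) (WU : W `<=` \val (tag s)) (WV : W `<=` \val (tag t)),
        oset W x /\ res F WU (tagged s) = res F WV (tagged t) >].

Lemma germ_equiv_is_equiv : equiv_class_of germ_equiv.
Proof.
split=> [s|s t|t s u].
- apply/asboolP; exists (\val (tag s)), (fun _ => id), (fun _ => id); split=> //.
  exact: set_mem (valP (tag s)).
- by apply/asboolP/asboolP => -[W [WU [WV [Wx e]]]]; exists W, WV, WU.
- move=> /asboolP[W [WU [WV [Wx e]]]] /asboolP[W' [WU' [WV' [Wx' e']]]].
  apply/asboolP; exists (oI W W').
  exists (subset_trans (@oIl _ W W') WU), (subset_trans (@oIr _ W W') WV').
  split=> //.
  rewrite -(res_comp WU (@oIl _ W W')) e
    (res_comp _ _ (subset_trans (@oIl _ W W') WV)).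
  by rewrite -(res_comp WV' (@oIr _ W W')) -e'
    (res_comp _ _ (subset_trans (@oIl _ W W') WV)).
Qed.

Canonical germ_equiv_rel := EquivRelPack germ_equiv_is_equiv.

Definition stalk := {eq_quot germ_equiv}.
HB.instance Definition _ := Choice.on stalk.

Definition germ (U : opens X) (Ux : oset U x) (s : F U) : stalk :=
  \pi_stalk (Tagged (fun U : {U : opens X | x \in oset U} => F (\val U))
               (s : F (\val (exist _ U (mem_set Ux) :
                             {U : opens X | x \in oset U})))).

Lemma germP (U V : opens X) (Ux : oset U x) (Vx : oset V x) (s : F U) (t : F V) :
  germ Ux s = germ Vx t <->
  exists (W : opens X) (WU : W `<=` U) (WV : W `<=` V),
    oset W x /\ res F WU s = res F WV t.
Proof.
split=> [/eqmodP /asboolP //|h].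
by apply/eqmodP/asboolP.
Qed.

Lemma germ_surj (g : stalk) : exists (U : opens X) (Ux : oset U x) (s : F U),
  g = germ Ux s.
Proof.
rewrite -[g]reprK; case: (repr g) => -[U Ux] /= s.
exists U, (set_mem Ux), s; rewrite /germ.
by rewrite (Prop_irrelevance (mem_set (set_mem Ux)) Ux).
Qed.

Lemma germ_res (U V : opens X) (Ux : oset U x) (Vx : oset V x) (VU : V `<=` U)
    (s : F U) :
  germ Vx (res F VU s) = germ Ux s.
Proof. by apply/germP; exists V, (fun _ => id), VU; rewrite res_id. Qed.

Definition stalk_zero : stalk := @germ oT I 0.

Definition stalk_opp (g : stalk) : stalk :=
  germ (set_mem (valP (tag (repr g)))) (- tagged (repr g)).

Definition stalk_add (g h : stalk) : stalk :=
  let U := \val (tag (repr g)) in let V := \val (tag (repr h)) in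
  @germ (oI U V) (conj (set_mem (valP (tag (repr g))))
                       (set_mem (valP (tag (repr h)))))
    (res F (@oIl _ U V) (tagged (repr g)) + res F (@oIr _ U V) (tagged (repr h))).

Lemma repr_germ (U : opens X) (Ux : oset U x) (s : F U) :
  germ (set_mem (valP (tag (repr (germ Ux s))))) (tagged (repr (germ Ux s)))
  = germ Ux s.
Proof.
rewrite -[RHS]reprK; case: (repr _) => -[V Vx] t /=.
by rewrite /germ /= (Prop_irrelevance (mem_set _) Vx).
Qed.

Lemma stalk_oppE (U : opens X) (Ux : oset U x) (s : F U) :
  stalk_opp (germ Ux s) = germ Ux (- s).
Proof.
have /germP[W [WU [WV [Wx e]]]] := repr_germ Ux s.
by apply/germP; exists W, WU, WV; rewrite !raddfN e.
Qed.

Lemma stalk_addE (U : opens X) (Ux : oset U x) (s t : F U) :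
  stalk_add (germ Ux s) (germ Ux t) = germ Ux (s + t).
Proof.
have /germP[W [WU [WV [Wx e]]]] := repr_germ Ux s.
have /germP[W' [WU' [WV' [Wx' e']]]] := repr_germ Ux t.
apply/germP; exists (oI W W'); pose l := @oIl _ W W'; pose r := @oIr _ W W'.
have WW : oI W W' `<=` \val (tag (repr (germ Ux s)))
                   `&` \val (tag (repr (germ Ux t))).
  by move=> y [Wy Wy']; split; [exact: (WU y)|exact: (WU' y)].
exists WW, (subset_trans l WV); split=> //; rewrite !raddfD; congr (_ + _).
- by rewrite (res_comp _ _ (subset_trans l WU)) -(res_comp WU l) e
             (res_comp _ _ (subset_trans l WV)).
- by rewrite (res_comp _ _ (subset_trans r WU')) -(res_comp WU' r) e'
             (res_comp _ _ (subset_trans l WV)).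
Qed.

Lemma germ_surj2 (g h : stalk) : exists (U : opens X) (Ux : oset U x) (s t : F U),
  g = germ Ux s /\ h = germ Ux t.
Proof.
have [U [Ux [s ->]]] := germ_surj g; have [V [Vx [t ->]]] := germ_surj h.
exists (oI U V), (conj Ux Vx : oset (oI U V) x).
exists (res F (@oIl _ U V) s), (res F (@oIr _ U V) t).
by rewrite !(germ_res Ux, germ_res Vx).
Qed.

Lemma stalk_zeroE (U : opens X) (Ux : oset U x) : stalk_zero = germ Ux 0.
Proof.
by apply/germP; exists U, (fun _ _ => I), (fun _ => id); rewrite !raddf0.
Qed.

Lemma stalk_addC : commutative stalk_add.
Proof.
move=> g h; have [U [Ux [s [t [-> ->]]]]] := germ_surj2 g h.
by rewrite !stalk_addE addrC.
Qed.

Lemma stalk_addA : associative stalk_add.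
Proof.
move=> f g h; have [U [Ux [s [t [-> ->]]]]] := germ_surj2 f g.
have [V [Vx [u ->]]] := germ_surj h.
rewrite -(germ_res Ux (conj Ux Vx : oset (oI U V) x) (@oIl _ U V) s).
rewrite -(germ_res Ux (conj Ux Vx : oset (oI U V) x) (@oIl _ U V) t).
rewrite -(germ_res Vx (conj Ux Vx : oset (oI U V) x) (@oIr _ U V) u).
by rewrite !stalk_addE addrA.
Qed.

Lemma stalk_add0 : left_id stalk_zero stalk_add.
Proof.
move=> g; have [U [Ux [s ->]]] := germ_surj g.
by rewrite (stalk_zeroE Ux) stalk_addE add0r.
Qed.

Lemma stalk_addN : left_inverse stalk_zero stalk_opp stalk_add.
Proof.
move=> g; have [U [Ux [s ->]]] := germ_surj g.
by rewrite stalk_oppE stalk_addE addNr (stalk_zeroE Ux).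
Qed.

HB.instance Definition _ :=
  GRing.isZmodule.Build stalk stalk_addA stalk_addC stalk_add0 stalk_addN.

Lemma germB (U : opens X) (Ux : oset U x) (s t : F U) :
  germ Ux (s - t) = germ Ux s - germ Ux t.
Proof. by rewrite -stalk_addE -stalk_oppE. Qed.

Lemma germ0 (U : opens X) (Ux : oset U x) : germ Ux (0 : F U) = 0.
Proof. by rewrite -stalk_zeroE. Qed.

End Stalk.

Section DependentProduct.
Variables (I : Type) (T : I -> zmodType).

Definition dprod := {classic forall i, T i}.
HB.instance Definition _ := Choice.on dprod.

Implicit Types f g h : dprod.

Definition dprod_zero : dprod := fun _ => 0.
Definition dprod_opp f : dprod := fun i => - f i.
Definition dprod_add f g : dprod := fun i => f i + g i.

Lemma dprod_addA : associative dprod_add.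
Proof. by move=> f g h; apply/functional_extensionality_dep => i; apply: addrA. Qed.
Lemma dprod_addC : commutative dprod_add.
Proof. by move=> f g; apply/functional_extensionality_dep => i; apply: addrC. Qed.
Lemma dprod_add0 : left_id dprod_zero dprod_add.
Proof. by move=> f; apply/functional_extensionality_dep => i; apply: add0r. Qed.
Lemma dprod_addN : left_inverse dprod_zero dprod_opp dprod_add.
Proof. by move=> f; apply/functional_extensionality_dep => i; apply: addNr. Qed.

HB.instance Definition _ :=
  GRing.isZmodule.Build dprod dprod_addA dprod_addC dprod_add0 dprod_addN.

End DependentProduct.

(* The sheaf of families (s_x : T x)_(x in U) that near each point of U belong
   to a prescribed class of "basic" families.  It is the common shape of the
   inverse image sheaf (T x a stalk, basic = given by one section) and of the
   constant sheaf (T x = A, basic = constant). *)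
Section LocalSections.
Variables (X : topologicalType) (T : X -> zmodType).

Definition family (U : opens X) : zmodType :=
  dprod (fun x : oset U => T (\val x)).

Definition frestrict (U V : opens X) (VU : V `<=` U) (s : family U) : family V :=
  fun x => s (incl VU x).

Lemma frestrict_id (U : opens X) (UU : U `<=` U) (s : family U) :
  frestrict UU s = s.
Proof.
apply/functional_extensionality_dep => -[x Ux]; rewrite /frestrict /incl /=.
by rewrite (Prop_irrelevance (mem_set _) Ux).
Qed.

Lemma frestrict_comp (U V W : opens X) (VU : V `<=` U) (WV : W `<=` V)
    (WU : W `<=` U) (s : family U) :
  frestrict WV (frestrict VU s) = frestrict WU s.
Proof.
apply/functional_extensionality_dep => x; rewrite /frestrict /incl /=.
by rewrite (Prop_irrelevance (mem_set _)
                             (mem_set (WU (\val x) (set_mem (valP x))))).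
Qed.

Lemma frestrictB (U V : opens X) (VU : V `<=` U) (s t : family U) :
  frestrict VU (s - t) = frestrict VU s - frestrict VU t.
Proof. by []. Qed.

Record basic_families := BasicFamilies {
  basic :> forall W : opens X, set (family W);
  basic0 : forall W, basic (0 : family W);
  basicB : forall W (s t : family W), basic s -> basic t -> basic (s - t);
  basic_res : forall (U V : opens X) (VU : V `<=` U) (s : family U),
    basic s -> basic (frestrict VU s)
}.

Variable B : basic_families.

Definition locally_basic (U : opens X) : pred (family U) := fun s =>
  `[< forall x : X, oset U x ->
      exists (W : opens X) (WU : W `<=` U), oset W x /\ B W (frestrict WU s) >].

Lemma locally_basic_zmod (U : opens X) : zmod_closed (@locally_basic U).
Proof.
split.
  by apply/asboolP => x Ux; exists U, (fun _ => id); split=> //; exact: basic0.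
move=> s t /asboolP ls /asboolP lt; apply/asboolP => x Ux.
have [W [WU [Wx Bs]]] := ls x Ux; have [W' [WU' [Wx' Bt]]] := lt x Ux.
exists (oI W W'), (subset_trans (@oIl _ W W') WU); split=> //.
have := basicB (basic_res (@oIl _ W W') Bs) (basic_res (@oIr _ W W') Bt).
by rewrite !(frestrict_comp _ _ (subset_trans (@oIl _ W W') WU)) -frestrictB.
Qed.

HB.instance Definition _ (U : opens X) :=
  GRing.isZmodClosed.Build (family U) (@locally_basic U) (locally_basic_zmod U).

Definition local_family (U : opens X) := {s : family U | s \in @locally_basic U}.
HB.instance Definition _ (U : opens X) := Choice.on (local_family U).
HB.instance Definition _ (U : opens X) := SubChoice.on (local_family U).
HB.instance Definition _ (U : opens X) :=
  [SubChoice_isSubZmodule of local_family U by <:].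

Lemma frestrict_local (U V : opens X) (VU : V `<=` U) (s : local_family U) :
  frestrict VU (\val s) \in @locally_basic V.
Proof.
apply/asboolP => x Vx.
have /asboolP ls := valP s; have [W [WU [Wx Bs]]] := ls x (VU x Vx).
exists (oI W V), (@oIr _ W V); split=> //.
have := basic_res (@oIl _ W V) Bs.
by rewrite !(frestrict_comp _ _ (subset_trans (@oIl _ W V) WU)).
Qed.

Definition lrestrict (U V : opens X) (VU : V `<=` U) (s : local_family U) :
  local_family V :=
  exist (fun f => f \in @locally_basic V) (frestrict VU (\val s))
        (frestrict_local VU s).

Lemma lrestrict_is_additive (U V : opens X) (VU : V `<=` U) :
  zmod_morphism (lrestrict VU).
Proof. by move=> s t; apply/val_inj. Qed.

HB.instance Definition _ (U V : opens X) (VU : V `<=` U) :=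
  GRing.isZmodMorphism.Build (local_family U) (local_family V) (lrestrict VU)
    (@lrestrict_is_additive U V VU).

Lemma lrestrict_id (U : opens X) (UU : U `<=` U) (s : local_family U) :
  lrestrict UU s = s.
Proof. by apply/val_inj; exact: frestrict_id. Qed.

Lemma lrestrict_comp (U V W : opens X) (VU : V `<=` U) (WV : W `<=` V)
    (WU : W `<=` U) (s : local_family U) :
  lrestrict WV (lrestrict VU s) = lrestrict WU s.
Proof. by apply/val_inj; exact: frestrict_comp. Qed.

Definition local_presheaf : presheaf X :=
  @Presheaf X (fun U => local_family U : zmodType)
    (fun U V VU => lrestrict VU) lrestrict_id lrestrict_comp.

Lemma local_is_sheaf : is_sheaf local_presheaf.
Proof.
move=> U I V VU cov; split=> [s t st|s scomp].
  apply/val_inj/functional_extensionality_dep => -[x Ux].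
  have [i _ Vix] := cov x (set_mem Ux).
  have := congr1 (fun f : local_family (V i) => \val f (exist _ x (mem_set Vix)))
                 (st i).
  rewrite /= /frestrict /incl /=.
  by rewrite (Prop_irrelevance (mem_set _) Ux).
have ex (x : oset U) : exists i, oset (V i) (\val x).
  by have [i _ Vix] := cov (\val x) (set_mem (valP x)); exists i.
pose t : family U := fun x =>
  \val (s (sval (cid (ex x)))) (exist _ (\val x) (mem_set (svalP (cid (ex x))))).
have glue i j x (Vix : x \in oset (V i)) (Vjx : x \in oset (V j)) :
    \val (s j) (exist _ x Vjx) = \val (s i) (exist _ x Vix).
  pose y : oset (oI (V j) (V i)) :=
    exist _ x (mem_set (conj (set_mem Vjx) (set_mem Vix)
                         : oset (oI (V j) (V i)) x)).
  have := congr1 (fun f : local_family (oI (V j) (V i)) => \val f y) (scomp j i).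
  rewrite /= /frestrict /incl /= (Prop_irrelevance (mem_set _) Vjx).
  by rewrite (Prop_irrelevance (mem_set _) Vix).
have tE i : frestrict (VU i) t = \val (s i).
  apply/functional_extensionality_dep => -[x Vix].
  pose e := svalP (cid (ex (incl (VU i) (exist _ x Vix)))).
  exact: (glue i _ x Vix (mem_set e)).
have tl : t \in @locally_basic U.
  apply/asboolP => x Ux; have [i _ Vix] := cov x Ux.
  have /asboolP/(_ x Vix)[W [WV [Wx Bs]]] := valP (s i).
  exists W, (subset_trans WV (VU i)); split=> //.
  by rewrite -(frestrict_comp (VU i) WV) tE.
exists (exist (fun f => f \in @locally_basic U) t tl) => i.
by apply/val_inj; exact: tE.
Qed.

Definition local_sheaf : sheaf X := Sheaf local_is_sheaf.

End LocalSections.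

Section InverseImage.
Variables (X Y : topologicalType) (f : continuousType X Y) (F : sheaf Y).

Let T (x : X) : zmodType := stalk F (f x).

Definition germ_family (W : opens X) : set (family T W) := [set s |
  exists (U : opens Y) (WU : forall x : oset W, oset U (f (\val x))) (t : F U),
    forall x : oset W, s x = germ (WU x) t].

Lemma germ_family0 (W : opens X) : germ_family (0 : family T W).
Proof. by exists oT, (fun _ => I), 0 => x; rewrite germ0. Qed.

Lemma germ_familyB (W : opens X) (s t : family T W) :
  germ_family s -> germ_family t -> germ_family (s - t).
Proof.
move=> [U [WU [u su]]] [V [WV [v tv]]].
pose WI (x : oset W) : oset (oI U V) (f (\val x)) := conj (WU x) (WV x).
exists (oI U V), WI, (res F (@oIl _ U V) u - res F (@oIr _ U V) v) => x.
by rewrite germB (germ_res (WU x)) (germ_res (WV x)) -su -tv.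
Qed.

Lemma germ_family_res (U V : opens X) (VU : V `<=` U) (s : family T U) :
  germ_family s -> germ_family (frestrict VU s).
Proof.
move=> [W [UW [t st]]]; exists W, (fun x => UW (incl VU x)), t => x.
exact: (st (incl VU x)).
Qed.

Definition inverse_image : sheaf X :=
  local_sheaf (BasicFamilies germ_family0 germ_familyB germ_family_res).

End InverseImage.

Definition restriction (X : topologicalType) (F : sheaf X) (S : set X) :
  sheaf S := inverse_image (\val : S -> X) F.

Definition restriction_sub (X : topologicalType) (S S' : set X) (SS' : S `<=` S')
  (F : sheaf S') : sheaf S := inverse_image (incl SS' : S -> S') F.

Section ConstantSheaf.
Variables (X : topologicalType) (A : zmodType).

Definition constant_family (W : opens X) : set (family (fun _ : X => A) W) :=
  [set s | exists a : A, forall x, s x = a].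

Lemma constant_family0 (W : opens X) : constant_family (0 : family _ W).
Proof. by exists 0. Qed.

Lemma constant_familyB (W : opens X) (s t : family (fun _ : X => A) W) :
  constant_family s -> constant_family t -> constant_family (s - t).
Proof.
by move=> [a sa] [b tb]; exists (a - b) => x; rewrite -(sa x) -(tb x).
Qed.

Lemma constant_family_res (U V : opens X) (VU : V `<=` U)
  (s : family (fun _ : X => A) U) :
  constant_family s -> constant_family (frestrict VU s).
Proof. by move=> [a sa]; exists a => x; exact: sa. Qed.

Definition constant_sheaf : sheaf X :=
  local_sheaf
    (BasicFamilies constant_family0 constant_familyB constant_family_res).

End ConstantSheaf.

Definition locally_constant_sheaf (X : topologicalType) (A : zmodType)
    (F : sheaf X) : Prop :=
  forall x : X, exists U : opens X,
    oset U x /\ isomorphic (restriction F U) (constant_sheaf (oset U) A).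

Section Cohomology.
Variable X : topologicalType.

(* The monomorphisms of sheaves are the morphisms injective on sections over
   every open set. *)
Definition mono_hom (F G : sheaf X) (f : sheaf_hom F G) : Prop :=
  forall U, injective (f U).

(* Exactness of sheaves at G, i.e. on stalks: local sections of ker g lift
   locally to F. *)
Definition exact_at (F G H : sheaf X) (f : sheaf_hom F G) (g : sheaf_hom G H) :
    Prop :=
  (forall (U : opens X) (s : F U), g U (f U s) = 0) /\
  (forall (U : opens X) (s : G U), g U s = 0 ->
     forall x : X, oset U x ->
     exists (V : opens X) (VU : V `<=` U) (t : F V),
       oset V x /\ f V t = res G VU s).

Definition injective_sheaf (J : sheaf X) : Prop :=
  forall (F G : sheaf X) (m : sheaf_hom F G) (f : sheaf_hom F J), mono_hom m ->
  exists g : sheaf_hom G J, forall U (s : F U), g U (m U s) = f U s.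

Record injective_resolution (F : sheaf X) := InjectiveResolution {
  term :> nat -> sheaf X;
  diff : forall p, sheaf_hom (term p) (term p.+1);
  aug : sheaf_hom F (term 0);
  term_injective : forall p, injective_sheaf (term p);
  aug_mono : mono_hom aug;
  aug_exact : exact_at aug (diff 0);
  diff_exact : forall p, exact_at (diff p) (diff p.+1)
}.

(* H^p(X, F) is the p-th cohomology group of the complex of global sections of
   an injective resolution J of F. *)
Variables (F : sheaf X) (J : injective_resolution F) (p : nat).

Definition is_cocycle : pred (J p oT) := fun s => diff J p oT s == 0.

Lemma is_cocycle_zmod : zmod_closed is_cocycle.
Proof.
split; first by rewrite /in_mem /= /is_cocycle raddf0.
move=> s t; rewrite /in_mem /= /is_cocycle => /eqP s0 /eqP t0.
by rewrite raddfB s0 t0 subr0.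
Qed.

HB.instance Definition _ :=
  GRing.isZmodClosed.Build (J p oT) is_cocycle is_cocycle_zmod.

Definition cocycle := {s : J p oT | s \in is_cocycle}.
HB.instance Definition _ := Choice.on cocycle.
HB.instance Definition _ := SubChoice.on cocycle.
HB.instance Definition _ := [SubChoice_isSubZmodule of cocycle by <:].

Definition coboundaries : set (J p oT) :=
  match p with
  | 0 => [set 0]
  | q.+1 => range (diff J q oT)
  end.

Definition is_coboundary : pred cocycle := fun z => `[< coboundaries (\val z) >].

Lemma is_coboundary_zmod : zmod_closed is_coboundary.
Proof.
have [c0 cB] : coboundaries 0 /\
    forall s t, coboundaries s -> coboundaries t -> coboundaries (s - t).
  rewrite /coboundaries; case: p => [|q]; split => //.
  - by move=> s t /= -> ->; rewrite subr0.
  - by exists 0 => //; rewrite raddf0.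
  - by move=> _ _ [s _ <-] [t _ <-]; exists (s - t) => //; rewrite raddfB.
split; first by apply/asboolP.
by move=> s t /asboolP cs /asboolP ct; apply/asboolP; exact: cB.
Qed.

HB.instance Definition _ :=
  GRing.isZmodClosed.Build cocycle is_coboundary is_coboundary_zmod.

Definition cohomology : zmodType :=
  Quotient.quot (GRing.ZmodClosed.clone cocycle is_coboundary _).

End Cohomology.

Definition closed_cube (R : realType) (n : nat) (a b : 'rV[R]_n) :
  set 'rV[R]_n := [set x | forall i, a 0 i <= x 0 i <= b 0 i].

(* Main.v *)
(* The terms of an injective resolution J of the sheaf on the cube X are flasque:
   J^p is a retract of its Godement sheaf.  For a subcube K of X, call N_e K the
   open box of the points of X whose coordinates are less than e away from those
   of K.  If K is cut by a hyperplane into K1 and K2, then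
   N_e K = N_e K1 \/ N_e K2 and N_e (K1 /\ K2) = N_e K1 /\ N_e K2.
   By induction on p one proves, up to decreasing e, that
   - a cocycle of J^p on N_e K extends to a cocycle on N_e K' for K <= K';
   - a cocycle of J^(p+1) on N_e K is a coboundary.
   The second assertion is local on K by exactness of J.  It passes from K1 and K2
   to K: two primitives differ on N_e (K1 /\ K2) by a cocycle of J^p, which
   extends to N_e K1 and corrects the first primitive so that they glue.  Hence it
   holds for every K, by repeated bisection down to a Lebesgue number.  It implies
   the extension property for J^(p+1), as primitives extend.  For p = 0,
   cocycles are sections of the locally constant sheaf, and the same bisection
   shows that a section on a box exists and is unique given its value at one
   point. *)

Require Import Defs.
From HB Require Import structures.
From mathcomp Require Import all_boot all_order all_algebra.
From mathcomp Require Import all_classical all_reals topology normedtype.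
From mathcomp Require Import generic_quotient ring_quotient lra.

Import Order.TTheory GRing.Theory Num.Theory.
Import numFieldNormedType.Exports.

Set Implicit Arguments.
Unset Strict Implicit.
Unset Printing Implicit Defensive.

Local Open Scope classical_set_scope.
Local Open Scope ring_scope.

(** * Bisection of cubes *)

Section Bisection.
Variables (R : realType) (n : nat).
Implicit Types (a b c d x y : 'rV[R]_n) (P : 'rV[R]_n -> 'rV[R]_n -> Prop).

(** The order is not strict, so that the common face of two halves of a cube, flat in the cut
    direction, still counts as a cube. *)
Definition row_le c d := forall i, c 0 i <= d 0 i.

Definition row_set c (i : 'I_n) (m : R) : 'rV[R]_n :=
  \row_j if j == i then m else c 0 j.

Lemma row_setE c i m j : row_set c i m 0 j = if j == i then m else c 0 j.
Proof. by rewrite mxE. Qed.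

Lemma row_ballP x y (e : R) : 0 < e ->
  ball x e y <-> forall i, x 0 i - e < y 0 i < x 0 i + e.
Proof.
move=> e0; split=> [[_ xy] i|xy].
  by have := xy 0 i; rewrite -ball_normE /= ltr_distlC.
by split=> // i j; rewrite (ord1 i) -ball_normE /= ltr_distlC.
Qed.

(** As [c <= d], the two one-sided bounds place the whole subcube within [e] of [x]. *)
Definition small_cubes a b P := forall x, closed_cube a b x ->
  exists2 e : R, 0 < e & forall c d, closed_cube a b c -> closed_cube a b d ->
    row_le c d -> (forall i, x 0 i - e < c 0 i) -> (forall i, d 0 i < x 0 i + e) ->
    P c d.

Definition bisected_cubes a b P := forall c d i m,
  closed_cube a b c -> closed_cube a b d -> row_le c d -> c 0 i <= m <= d 0 i ->
  P c (row_set d i m) -> P (row_set c i m) d -> P c d.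

(** A product of segments is compact; the near-covering form of compactness makes the [e] attached
    to each point uniform. *)
Lemma lebesgue_number a b P : small_cubes a b P ->
  exists2 e : R, 0 < e & forall c d, closed_cube a b c -> closed_cube a b d ->
    row_le c d -> (forall i, d 0 i < c 0 i + e) -> P c d.
Proof.
move=> Ploc.
have : compact (closed_cube a b).
  have := @rV_compact R n (fun i => `[a 0 i, b 0 i]%classic) (fun i => @segment_compact _ _ _).
  congr compact; apply/seteqP; split=> x /= h i; have := h i; rewrite ?in_itv //.
move=> /compact_near_coveringP cover.
pose Q e c := forall d, closed_cube a b c -> closed_cube a b d ->
    row_le c d -> (forall i, d 0 i < c 0 i + e) -> P c d.
suff /cover he : forall x, closed_cube a b x -> \forall y \near x & e \near 0^'+, Q e y.
  have [e [e_gt0 he']] := filter_ex (filterI (nbhs_right_gt (0 : R)) he).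
  by exists e => // c d abc; exact: he'.
move=> x /Ploc[e e0 Pe].
have e20 : 0 < e / 2 by lra.
(* One half of [e] bounds the distance from [x] to [c], the other the sides of the subcube. *)
exists (ball x (e / 2), [set r : R | r < e / 2]).
  by split=> /=; [exact: nbhsx_ballx | exact: nbhs_right_lt].
case=> c r [/= /(row_ballP _ _ e20) xc re] d abc abd cd dc.
by apply: (Pe) => // i; have := xc i; have := dc i; lra.
Qed.

(** Side [i] is kept below [e * 2 ^+ k i], with [e] a Lebesgue number. Cutting it at its midpoint
    lowers [k i] by one, so induction on a bound [N] of the sum of the [k i] ends at cubes of sides
    below [e]. *)
Lemma cube_bisection a b P : row_le a b ->
  small_cubes a b P -> bisected_cubes a b P -> P a b.
Proof.
move=> ab /lebesgue_number[e e0 Pe] Pbis.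
suff main : forall N (k : 'I_n -> nat), (\sum_i k i <= N)%N -> forall c d,
   closed_cube a b c -> closed_cube a b d -> row_le c d ->
   (forall i, d 0 i < c 0 i + e * 2 ^+ k i) -> P c d.
  have [k hk] : exists k : 'I_n -> nat, forall i, b 0 i < a 0 i + e * 2 ^+ k i.
    suff hk i : exists k, b 0 i < a 0 i + e * 2 ^+ k.
      by exists (fun i => sval (cid (hk i))) => i; exact: svalP (cid (hk i)).
    have [k hk] : exists k : nat, (b 0 i - a 0 i) / e < k%:R.
      exists (Num.truncn ((b 0 i - a 0 i) / e)).+1.
      by rewrite truncnS_gt.
    (* [2 ^+ k] exceeds [k], which exceeds the ratio of the side to [e]. *)
    exists k; rewrite -ltrBlDl mulrC -ltr_pdivrMr //; apply: (lt_trans hk).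
    by rewrite -natrX ltr_nat ltn_expl.
  apply: (main _ k (leqnn _)) => // i; rewrite ?lexx ?ab //.
elim=> [|N IH] k hN c d abc abd cd kcd.
  apply: Pe => // i; move: hN; rewrite leqn0 sum_nat_eq0 => /forallP/(_ i)/= /eqP ki.
  by have := kcd i; rewrite ki expr0 mulr1.
(* The sum is only bounded by [N.+1], so every [k i] may already be zero. *)
have [k0|] := pselect (forall i, k i = 0%N).
  by apply: Pe => // i; have := kcd i; rewrite k0 expr0 mulr1.
move=> /existsNP[i /eqP]; rewrite -lt0n => ki.
pose k' j := if j == i then (k i).-1 else k j.
have hk' : (\sum_i k' i <= N)%N.
  rewrite -ltnS; apply: leq_trans hN.
  rewrite [X in (X < _)%N](bigD1 i) //= [X in (_ < X)%N](bigD1 i) //= /k' eqxx.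
  rewrite (eq_bigr k) => [|j /negbTE-> //].
  by rewrite -addSn prednK.
have e2 : e * 2 ^+ k i = e * 2 ^+ (k i).-1 * 2.
  by rewrite -[in LHS](prednK ki) exprSr mulrA.
pose m := (c 0 i + d 0 i) / 2.
have cdi := cd i; have kcdi := kcd i; rewrite e2 in kcdi.
have mi : c 0 i <= m <= d 0 i by rewrite /m; apply/andP; split; lra.
apply: (Pbis c d i m) => //; apply: (IH k' hk') => // j; rewrite ?row_setE.
- case: eqP => [->|_ //]; have := abc i; have := abd i; lra.
- by case: eqP => [->|_ //]; lra.
- rewrite /k'; case: eqP => [->|_ //]; rewrite /m; lra.
- case: eqP => [->|_ //]; have := abc i; have := abd i; lra.
- by case: eqP => [->|_ //]; lra.
- rewrite /k'; case: eqP => [->|_ //]; rewrite /m; lra.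
Qed.

End Bisection.

(** * Injective sheaves are flasque *)

Section SheafLemmas.
Variable X : topologicalType.
Implicit Types (F G : sheaf X) (U V W : opens X).

Lemma sheaf_ext F U (s t : F U) :
  (forall x, oset U x -> exists V (VU : V `<=` U),
     oset V x /\ res F VU s = res F VU t) -> s = t.
Proof.
move=> st; pose I := {V : opens X & {VU : V `<=` U | res F VU s = res F VU t}}.
pose VU (i : I) : tag i `<=` U := sval (tagged i).
have cov : U `<=` \bigcup_(i : I) (tag i : set X).
  move=> x /st[V [VU' [Vx e]]].
  by exists (Tagged (fun V : opens X => {VU : V `<=` U | _}) (exist _ VU' e)).
by apply: (sheafP F VU cov).1 => i; exact: svalP (tagged i).
Qed.

(** The hypotheses force [W] to be the intersection of [V1] and [V2]; leaving its description free
    lets a box play this role. *)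
Lemma sheaf_glue2 F U V1 V2 W (V1U : V1 `<=` U) (V2U : V2 `<=` U)
    (WV1 : W `<=` V1) (WV2 : W `<=` V2) (s1 : F V1) (s2 : F V2) :
  (U : set X) `<=` (V1 : set X) `|` V2 -> (V1 : set X) `&` V2 `<=` W ->
  res F WV1 s1 = res F WV2 s2 ->
  exists s : F U, res F V1U s = s1 /\ res F V2U s = s2.
Proof.
move=> UV VW e; pose V b := if b then V1 else V2.
pose VU b : V b `<=` U := if b is true then V1U else V2U.
have cov : U `<=` \bigcup_b (V b : set X).
  by move=> x /UV[Vx|Vx]; [exists true|exists false].
have [_ /(_ (fun b => if b is true then s1 else s2))[|s sE]] := sheafP F VU cov.
  have key V' (h1 : V' `<=` V1) (h2 : V' `<=` V2) : res F h1 s1 = res F h2 s2.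
    have V'W : V' `<=` W by move=> x V'x; apply: VW; split; [exact: h1|exact: h2].
    by rewrite -(res_comp WV1 V'W) e res_comp.
  case=> -[] /=.
  - by rewrite (Prop_irrelevance (@oIl _ V1 V1) (@oIr _ V1 V1)).
  - exact: key.
  - by apply/esym; exact: key.
  - by rewrite (Prop_irrelevance (@oIl _ V2 V2) (@oIr _ V2 V2)).
by exists s; split; [exact: (sE true)|exact: (sE false)].
Qed.

(** Injectivity of [f] makes local lifts unique, so they agree on overlaps and glue. *)
Lemma mono_lift F G (f : sheaf_hom F G) U (r : G U) : mono_hom f ->
  (forall x, oset U x -> exists V (VU : V `<=` U) (t : F V),
     oset V x /\ f V t = res G VU r) ->
  exists t : F U, f U t = r.
Proof.
move=> fmono lift.
pose I := {V : opens X & {VU : V `<=` U & {t : F V | f V t = res G VU r}}}.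
pose VU (i : I) : tag i `<=` U := tag (tagged i).
have cov : U `<=` \bigcup_(i : I) (tag i : set X).
  move=> x /lift[V [VU' [t [Vx e]]]].
  by exists (Tagged (fun V : opens X => {VU : V `<=` U & {t : F V | _}})
              (Tagged (fun VU : V `<=` U => {t : F V | _}) (exist _ t e))).
have [_ /(_ (fun i => sval (tagged (tagged i))))[|t tE]] := sheafP F VU cov.
  have fE (i : I) : f _ (sval (tagged (tagged i))) = res G (VU i) r.
    exact: svalP (tagged (tagged i)).
  move=> i j; apply: fmono; rewrite !hom_nat !fE.
  by rewrite !(res_comp _ _ (subset_trans (@oIl _ _ _) (VU i))).
exists t; apply: sheaf_ext => x /lift[V [VU' [t' [Vx e]]]].
exists V, VU'; split=> //; rewrite -hom_nat.
have := tE (Tagged (fun V : opens X => {VU : V `<=` U & {t : F V | _}})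
              (Tagged (fun VU : V `<=` U => {t : F V | _}) (exist _ t' e))).
rewrite /VU /= => ->; exact: e.
Qed.

(** With no condition on families, the local sheaf consists of all, possibly discontinuous,
    families. *)
Definition all_families (T : X -> zmodType) : basic_families T :=
  @BasicFamilies X T (fun _ => setT) (fun _ => I) (fun _ _ _ _ _ => I)
    (fun _ _ _ _ _ => I).

Definition godement F : sheaf X :=
  local_sheaf (all_families (fun x => stalk F x : zmodType)).

Lemma all_familiesP (T : X -> zmodType) U (s : Defs.family T U) :
  s \in @locally_basic X T (all_families T) U.
Proof. by apply/asboolP => x Ux; exists U, (fun _ => id). Qed.

Definition germs F U (s : F U) : godement F U :=
  exist (fun f => f \in @locally_basic X _ (all_families _) U)
    (fun x : oset U => germ (set_mem (valP x)) s) (all_familiesP _).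

Lemma germs_is_additive F U : zmod_morphism (@germs F U).
Proof.
move=> s t; apply/val_inj/functional_extensionality_dep => x; exact: germB.
Qed.

HB.instance Definition _ F U :=
  GRing.isZmodMorphism.Build (F U) (godement F U) (@germs F U)
    (@germs_is_additive F U).

Lemma germs_natural F U V (VU : V `<=` U) (s : F U) :
  germs (res F VU s) = res (godement F) VU (germs s).
Proof.
by apply/val_inj/functional_extensionality_dep => x; exact: germ_res.
Qed.

Definition godement_hom F : sheaf_hom F (godement F) :=
  @SheafHom X F (godement F) (fun U => @germs F U) (@germs_natural F).

Lemma godement_hom_mono F : mono_hom (godement_hom F).
Proof.
move=> U s t st; apply: sheaf_ext => x Ux.
have /germP[V [VU [VU' [Vx e]]]] :
    germ Ux s = germ Ux t.
  have := congr1 (fun f : godement F U => \val f (exist _ x (mem_set Ux))) st.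
  by rewrite /= (Prop_irrelevance (set_mem _) Ux).
by exists V, VU; rewrite e (Prop_irrelevance VU' VU).
Qed.

Definition id_hom F : sheaf_hom F F :=
  @SheafHom X F F (fun U => idfun : {additive F U -> F U}) (fun _ _ _ _ => erefl).

Lemma godement_flasque F U V (VU : V `<=` U) (s : godement F V) :
  exists t : godement F U, res (godement F) VU t = s.
Proof.
(* Extension by zero outside [V]. *)
pose t : Defs.family (fun x => stalk F x : zmodType) U := fun x =>
  if pselect (oset V (\val x)) is left Vx then \val s (exist _ (\val x) (mem_set Vx))
  else 0.
exists (exist (fun f => f \in @locally_basic X _ (all_families _) U) t
          (all_familiesP t)).
apply/val_inj/functional_extensionality_dep => -[x Vx].
rewrite /= /frestrict /t /=; case: pselect => [Vx'|/(_ (set_mem Vx))//].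
by rewrite (Prop_irrelevance (mem_set _) Vx).
Qed.

(** Injectivity extends the identity of [F] along [godement_hom] to a retraction [r]; extend the
    germs of [s], then apply [r]. *)
Lemma injective_flasque F U V (VU : V `<=` U) (s : F V) :
  injective_sheaf F -> exists t : F U, res F VU t = s.
Proof.
move=> /(_ _ _ _ (id_hom F) (@godement_hom_mono F))[r rE].
have [t tE] := godement_flasque VU (godement_hom F V s).
by exists (r U t); rewrite -hom_nat tE rE.
Qed.

End SheafLemmas.

(** * Sections of inverse images *)

Section Values.
Variables (X : topologicalType) (T : X -> zmodType) (B : basic_families T).
Implicit Types U V W : opens X.

(** Membership is passed as a proof in [Prop], which keeps points of the subtype out of later
    statements. *)
Definition value U (s : local_sheaf B U) x (Ux : oset U x) : T x :=
  \val (s : local_family B U) (exist _ x (mem_set Ux)).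

Lemma frestrict_value U V (VU : V `<=` U) (s : local_sheaf B U) x (Vx : oset V x)
    (Ux : oset U x) :
  frestrict VU (\val (s : local_family B U)) (exist _ x (mem_set Vx)) = value s Ux.
Proof.
by congr (\val (s : local_family B U) (exist _ x _)); exact: Prop_irrelevance.
Qed.

Lemma value_res U V (VU : V `<=` U) (s : local_sheaf B U) x (Vx : oset V x)
    (Ux : oset U x) :
  value (res (local_sheaf B) VU s) Vx = value s Ux.
Proof.
exact: frestrict_value.
Qed.

Lemma value_ext U (s t : local_sheaf B U) :
  (forall x (Ux : oset U x), value s Ux = value t Ux) -> s = t.
Proof.
move=> st; apply/val_inj/functional_extensionality_dep => -[x Ux].
by have := st x (set_mem Ux); rewrite /value (Prop_irrelevance (mem_set _) Ux).
Qed.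

Lemma value_local U (s : local_sheaf B U) x : oset U x ->
  exists V (VU : V `<=` U), oset V x /\ B V (frestrict VU (\val (s : local_family B U))).
Proof. by move=> Ux; have /asboolP/(_ x Ux) := valP (s : local_family B U). Qed.

End Values.

Definition preimage_opens (X Y : topologicalType) (f : continuousType X Y)
    (U : opens Y) : opens X :=
  exist _ (f @^-1` U)
    (mem_set ((continuousP f).1 (@cts_fun _ _ f) _ (oset_open U))).

Section InverseImageSections.
Variables (X Y : topologicalType) (f : continuousType X Y) (F : sheaf Y).
Implicit Types U V W : opens X.

Lemma inverse_image_germ W (s : inverse_image f F W) x : oset W x ->
  exists V (VW : V `<=` W) (U : opens Y) (VU : V `<=` f @^-1` U) (t : F U),
    oset V x /\ forall y (Vy : oset V y) (Wy : oset W y),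
      value s Wy = germ (VU y Vy) t.
Proof.
move=> /(value_local s)[V [VW [Vx [U [VU [t st]]]]]].
have VU' : V `<=` f @^-1` U by move=> y Vy; exact: (VU (exist _ y (mem_set Vy))).
exists V, VW, U, VU', t; split=> // y Vy Wy.
rewrite -(frestrict_value VW s Vy Wy) st.
by congr germ; exact: Prop_irrelevance.
Qed.

Lemma inverse_image_section W (v : forall x, oset W x -> stalk F (f x)) :
  (forall x, oset W x -> exists V (VW : V `<=` W) (U : opens Y)
      (VU : V `<=` f @^-1` U) (t : F U),
    oset V x /\ forall y (Vy : oset V y), v y (VW y Vy) = germ (VU y Vy) t) ->
  exists s : inverse_image f F W, forall x (Wx : oset W x), value s Wx = v x Wx.
Proof.
move=> vloc.
pose s : Defs.family (fun x => stalk F (f x) : zmodType) W :=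
  fun x => v (\val x) (set_mem (valP x)).
have sl : s \in locally_basic (BasicFamilies (@germ_family0 X Y f F)
    (@germ_familyB X Y f F) (@germ_family_res X Y f F)) (U := W).
  apply/asboolP => x /vloc[V [VW [U [VU [t [Vx vt]]]]]].
  exists V, VW; split=> //; exists U, (fun y => VU _ (set_mem (valP y))), t => y.
  rewrite -vt /frestrict /s /incl /=.
  by congr v; exact: Prop_irrelevance.
exists (exist (fun f => f \in locally_basic _ (U := W)) s sl) => x Wx.
by rewrite /value /= /s /=; congr v; exact: Prop_irrelevance.
Qed.

(** Near [x] both sections come from sections of [F]; equal germs mean that these coincide on some
    open [O], and the preimage of [O] serves. *)
Lemma inverse_image_agree W (s t : inverse_image f F W) x (Wx : oset W x) :
  value s Wx = value t Wx ->
  exists V (VW : V `<=` W), oset V x /\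
    res (inverse_image f F) VW s = res (inverse_image f F) VW t.
Proof.
have [V [VW [U [VU [u [Vx su]]]]]] := inverse_image_germ s Wx.
have [V' [VW' [U' [VU' [u' [Vx' tu]]]]]] := inverse_image_germ t Wx.
rewrite (su _ Vx) (tu _ Vx') => /germP[O [OU [OU' [Ox e]]]].
exists (oI (oI V V') (preimage_opens f O)).
exists (subset_trans (@oIl _ _ _) (subset_trans (@oIl _ _ _) VW)).
split=> //; apply: value_ext => y yV; have [[Vy Vy'] Oy] := yV.
rewrite !(value_res _ _ _ (VW _ Vy)) (su _ Vy) (tu _ Vy').
by apply/germP; exists O, OU, OU'.
Qed.

End InverseImageSections.

Lemma const_section_subproof (X : topologicalType) (A : zmodType) (a : A) :
  ((fun=> a) : Defs.family (fun _ : X => A) oT) \in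
  locally_basic (BasicFamilies (@constant_family0 X A) (@constant_familyB X A)
    (@constant_family_res X A)) (U := oT).
Proof.
by apply/asboolP => x _; exists oT, (fun _ => id); split=> //; exists a.
Qed.

Definition const_section (X : topologicalType) (A : zmodType) (a : A) :
    constant_sheaf X A oT :=
  exist (fun s => s \in locally_basic _ (U := oT)) _ (const_section_subproof X a).

(** Pull back the constant sections of a trivialisation of [F] near [f x]: their values run through
    each nearby stalk exactly once. *)
Lemma locally_constant_values (X Y : topologicalType) (f : continuousType X Y)
    (A : zmodType) (F : sheaf Y) : locally_constant_sheaf A F ->
  forall x : X, exists (U : opens X) (s : A -> inverse_image f F U),
    [/\ oset U x,
        forall y (Uy : oset U y) (g : stalk F (f y)), exists a, value (s a) Uy = g &
        forall y (Uy : oset U y) a b, value (s a) Uy = value (s b) Uy -> a = b].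
Proof.
move=> Fconst x; have [U0 [U0x [g [h gh]]]] := Fconst (f x).
pose z y (Uy : oset U0 y) : U0 := exist _ y (mem_set Uy).
pose tau a := h oT (const_section U0 a).
(* A value of a section of [restriction F U0] at [z] is already a germ of [F] at [f y]. *)
pose v a y (Uy : oset (preimage_opens f U0) y) : stalk F (f y) :=
  value (tau a) (I : oset oT (z _ Uy)).
have vloc a : exists s : inverse_image f F (preimage_opens f U0),
    forall y (Uy : oset (preimage_opens f U0) y), value s Uy = v a y Uy.
  apply: inverse_image_section => y Uy.
  have [V [VW [U [VU [t [Vz vt]]]]]] :=
    inverse_image_germ (tau a) (I : oset oT (z _ Uy)).
  (* [V] is open in the subspace [U0], hence the trace of an open [O] of [Y], which can be pulled
     back by [f]. *)
  have [O oO OV] := oset_open V.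
  have OVE q (Uq : oset U0 q) : O q = oset V (z q Uq) by rewrite -OV.
  pose O' : opens Y := exist _ O (mem_set oO).
  pose V' := oI (preimage_opens f O') (preimage_opens f U0).
  have V'V q (V'q : oset V' q) : oset V (z (f q) (@oIr _ _ _ _ V'q)).
    by rewrite -OVE; exact: V'q.1.
  exists V', (@oIr _ _ _), U, (fun q V'q => VU _ (V'V q V'q)), t.
  split; first by split=> //; have := Vz; rewrite -OVE.
  by move=> q V'q; rewrite /v (vt _ (V'V q V'q)).
pose s a := sval (cid (vloc a)).
have sE a y (Uy : oset (preimage_opens f U0) y) : value (s a) Uy = v a y Uy.
  exact: (svalP (cid (vloc a))).
exists (preimage_opens f U0), s; split=> // y Uy;
  pose Tz : oset oT (z _ Uy) := I; [move=> p|move=> a b].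
  (* Surjectivity: represent the germ by a section [t], view [t] as a section [s0] of the
     restriction, and read off the constant [a] to which [g] sends it near [z]. *)
  have [O [Oy [t tp]]] := germ_surj p.
  pose W := preimage_opens (\val : U0 -> Y) O.
  have [s0 s0E] : exists s0 : restriction F U0 W, forall q (Wq : oset W q),
      value s0 Wq = germ (Wq : oset O (\val q)) t.
    apply: inverse_image_section => q Wq.
    by exists W, (fun _ => id), O, (fun _ => id), t.
  pose Wz : oset W (z _ Uy) := Oy.
  have [V [VW [Vz [a ga]]]] := value_local (g W s0) Wz.
  exists a; rewrite sE /v tp.
  have VT : V `<=` oT by [].
  have e : res (restriction F U0) VW s0 = res (restriction F U0) VT (tau a).
    rewrite -[LHS](gh V).1 /tau -(hom_nat h) (hom_nat g); congr (h V _).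
    apply: value_ext => q Vq; rewrite (value_res _ _ _ (VW q Vq)).
    by rewrite -(frestrict_value VW _ Vq) ga.
  have := congr1 (fun s : restriction F U0 V => value s Vz) e.
  by rewrite (value_res _ _ _ Wz) (value_res _ _ _ Tz) s0E => {}e; exact: esym e.
(* Injectivity: equality at one point spreads to an open [V], where [h] is injective, so the two
   constants coincide. *)
rewrite !sE /v => ab.
have [V [VT [Vz]]] := inverse_image_agree (ab : value (tau a) Tz = value (tau b) Tz).
rewrite -!hom_nat => /(can_inj (gh V).2)/(congr1 (fun s => value s Vz)).
by rewrite !(value_res _ _ _ Tz).
Qed.

(** * Neighbourhoods of subcubes *)

Section Restrictions.
Variables (X : topologicalType) (F : presheaf X).
Implicit Types U V W : opens X.

Lemma res_irr U V (VU VU' : V `<=` U) (s : F U) : res F VU s = res F VU' s.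
Proof. by rewrite (Prop_irrelevance VU VU'). Qed.

Lemma res_trans U V W (VU : V `<=` U) (WV : W `<=` V) (s : F U) :
  res F WV (res F VU s) = res F (subset_trans WV VU) s.
Proof. exact: res_comp. Qed.

End Restrictions.

Section CubeNeighborhoods.
Variables (R : realType) (n : nat) (a b : 'rV[R]_n).
Implicit Types (c d : 'rV[R]_n) (e m : R).
Local Notation X := (set_type (closed_cube a b)).
Local Notation pt := (\val : X -> 'rV[R]_n).

Lemma closed_cube_sub c d x : closed_cube a b c -> closed_cube a b d ->
  closed_cube c d x -> closed_cube a b x.
Proof. by move=> abc abd cdx i; have := abc i; have := abd i; have := cdx i; lra. Qed.

Lemma closed_cubel c d : row_le c d -> closed_cube c d c.
Proof. by move=> cd i; rewrite lexx cd. Qed.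

Lemma closed_cuber c d : row_le c d -> closed_cube c d d.
Proof. by move=> cd i; rewrite lexx cd. Qed.

(** The box [N_e K] inside the big cube, for [K] the subcube with extreme corners [c] and [d]. *)
Definition thick_set c d e : set X :=
  [set x | forall i, c 0 i - e < (pt x) 0 i < d 0 i + e].

Lemma thick_set_open c d e : open (thick_set c d e).
Proof.
exists [set x : 'rV[R]_n | forall i, c 0 i - e < x 0 i < d 0 i + e] => //.
rewrite openE => x /= xcd.
apply: (@filter_forall _ _
  (fun i (y : 'rV[R]_n) => c 0 i - e < y 0 i < d 0 i + e) (nbhs x)) => i.
have itvx : nbhs (x 0 i) (`]c 0 i - e, d 0 i + e[%classic).
  by apply: open_nbhs_nbhs; split; [exact: interval_open|rewrite /= in_itv /= xcd].
have := @coord_continuous R 1 n 0 i x _ itvx; rewrite nbhs_simpl /=.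
by apply: filterS => y; rewrite /= in_itv.
Qed.

Definition thick c d e : opens X := 
  exist _ (thick_set c d e) (mem_set (thick_set_open c d e)).

Lemma thickS c d c' d' e e' : row_le c' c -> row_le d d' -> e <= e' ->
  thick c d e `<=` thick c' d' e'.
Proof. by move=> cc dd ee x xe i; have := xe i; have := cc i; have := dd i; lra. Qed.

Lemma thick_le c d e e' : e <= e' -> thick c d e `<=` thick c d e'.
Proof. by move=> ee; apply: thickS. Qed.

Lemma closed_cube_thick c d e (x : X) : 0 < e -> closed_cube c d (pt x) ->
  oset (thick c d e) x.
Proof. by move=> e0 cdx i; have := cdx i; lra. Qed.

Lemma open_thick (V : opens X) (x : X) : oset V x ->
  exists2 e, 0 < e & forall c d, (forall i, (pt x) 0 i - e < c 0 i) ->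
    (forall i, d 0 i < (pt x) 0 i + e) -> thick c d e `<=` V.
Proof.
have [O oO OV] := oset_open V; rewrite -OV /= => Ox.
have /nbhs_ballP[e /= e0 eO] := open_nbhs_nbhs (conj oO Ox).
(* Half of the radius is for the position of the subcube, half for its thickening. *)
have e20 : 0 < e / 2 by lra.
exists (e / 2) => // c d xc dx y ycd; apply: eO.
by apply/row_ballP => // i; have := ycd i; have := xc i; have := dx i; lra.
Qed.

Section Halves.
Variables (c d : 'rV[R]_n) (i : 'I_n) (m : R).
Hypotheses (cd : row_le c d) (cmd : c 0 i <= m <= d 0 i).
Let c' := row_set c i m.
Let d' := row_set d i m.

Lemma row_set_lel : row_le c c'.
Proof. by move=> j; rewrite row_setE; case: eqP => [->|//]; case/andP: cmd. Qed.

Lemma row_set_ler : row_le d' d.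
Proof. by move=> j; rewrite row_setE; case: eqP => [->|//]; case/andP: cmd. Qed.

Lemma row_set_le : row_le c' d'.
Proof. by move=> j; rewrite !row_setE; case: eqP => // _; exact: cd. Qed.

Lemma closed_cube_halves x : closed_cube c d x ->
  closed_cube c d' x \/ closed_cube c' d x.
Proof.
move=> cdx; have [xm|mx] := leP (x 0 i) m; [left|right] => j; have := cdx j;
  rewrite row_setE; case: eqP => [->|_]; lra.
Qed.

Lemma thick_halves (x : X) e : 0 < e -> oset (thick c d e) x ->
  oset (thick c d' e) x \/ oset (thick c' d e) x.
Proof.
(* The threshold is [m + e], where the box of the lower half ends; beyond it a point is above
   [m - e]. *)
move=> e0 xcd; have [xm|mx] := ltP ((pt x) 0 i) (m + e); [left|right] => j;
  have := xcd j; rewrite row_setE; case: eqP => [->|_]; lra.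
Qed.

(** The boxes of the two halves cover the box of the cube and meet exactly in the box of the common
    face. *)
Lemma glue_halves (F : sheaf X) e (s1 : F (thick c d' e)) (s2 : F (thick c' d e))
    (h1 : thick c' d' e `<=` thick c d' e) (h2 : thick c' d' e `<=` thick c' d e)
    (k1 : thick c d' e `<=` thick c d e) (k2 : thick c' d e `<=` thick c d e) :
  0 < e -> res F h1 s1 = res F h2 s2 ->
  exists s : F (thick c d e), res F k1 s = s1 /\ res F k2 s = s2.
Proof.
move=> e0; apply: sheaf_glue2 => x /=; first exact: thick_halves.
by move=> [x1 x2] j; have := x1 j; have := x2 j; rewrite !row_setE;
  case: eqP => [->|_]; lra.
Qed.

End Halves.
End CubeNeighborhoods.

(** * Unique continuation and extension of sections of a locally constant sheaf *)

Section LocallyConstant.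
Variables (R : realType) (n : nat) (a b : 'rV[R]_n).
Local Notation X := (set_type (closed_cube a b)).
Local Notation pt := (\val : X -> 'rV[R]_n).
Variables (Y : topologicalType) (f : continuousType X Y) (A : zmodType).
Variables (F : sheaf Y) (Fconst : locally_constant_sheaf A F).
Local Notation G := (inverse_image f F).
Implicit Types (c d : 'rV[R]_n) (e : R) (U V W : opens X).

Definition agree W (s t : G W) (x : X) :=
  exists Wx : oset W x, value s Wx = value t Wx.

(** In a trivialisation both sections are constants [p] and [q] near [x]; agreement at a single
    point there gives [p = q]. *)
Lemma agree_locally_constant W (s t : G W) x : oset W x ->
  exists2 V : opens X, oset V x &
    forall y z, oset V y -> oset V z -> agree s t y -> agree s t z.
Proof.
move=> Wx; have [U [sg [Ux sg_surj sg_inj]]] := locally_constant_values f Fconst x.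
have near_sg (r : G W) : exists p (V : opens X) (VW : V `<=` W) (VU : V `<=` U),
    oset V x /\ res G VW r = res G VU (sg p).
  have [p pE] := sg_surj _ Ux (value r Wx).
  pose WU := oI W U; have WUx : oset WU x by [].
  have [V [VWU [Vx e]]] : exists V (VWU : V `<=` WU), oset V x /\
      res G VWU (res G (@oIl _ W U) r) = res G VWU (res G (@oIr _ W U) (sg p)).
    apply: (inverse_image_agree (Wx := WUx)).
    by rewrite (value_res _ _ _ Wx) (value_res _ _ _ Ux) pE.
  exists p, V, (subset_trans VWU (@oIl _ W U)), (subset_trans VWU (@oIr _ W U)).
  by rewrite -!res_trans.
have [p [V [VW [VU [Vx sE]]]]] := near_sg s.
have [q [V' [VW' [VU' [Vx' tE]]]]] := near_sg t.
exists (oI V V') => // y z [Vy Vy'] [Vz Vz'] [Wy st].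
exists (VW _ Vz); rewrite -(value_res VW s Vz) sE (value_res _ _ _ (VU _ Vz)).
rewrite -(value_res VW' t Vz') tE (value_res _ _ _ (VU _ Vz)).
suff -> : p = q by []; apply: (sg_inj y (VU _ Vy)).
move: st; rewrite -(value_res VW s Vy) sE (value_res _ _ _ (VU _ Vy)).
by rewrite -(value_res VW' t Vy') tE (value_res _ _ _ (VU _ Vy)).
Qed.

(** By bisection: agreement crosses from one half to the other through a point of their common
    face. *)
Lemma agree_cube W (s t : G W) c d : closed_cube a b c -> closed_cube a b d ->
  row_le c d -> (forall x : X, closed_cube c d (pt x) -> oset W x) ->
  forall x y : X, closed_cube c d (pt x) -> closed_cube c d (pt y) ->
  agree s t x -> agree s t y.
Proof.
move=> abc abd cd cdW.
pose P c d := forall x y : X, closed_cube c d (pt x) ->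
  closed_cube c d (pt y) -> agree s t x -> agree s t y.
apply: (@cube_bisection _ _ c d P) => //.
- move=> x cdx; pose x' : X := exist _ x (mem_set (closed_cube_sub abc abd cdx)).
  have [V Vx Vagree] := agree_locally_constant s t (cdW x' cdx).
  have [e e0 eV] := open_thick Vx; exists e => // c' d' _ _ _ xc dx y z cdy cdz.
  have VcV := eV _ _ xc dx.
  by apply: Vagree; apply: VcV; exact: closed_cube_thick.
- move=> c' d' i m cdc cdd cd' cmd P1 P2.
  (* The lowest corner of the common face, which lies in both halves. *)
  pose p := row_set c' i m.
  have p1 : closed_cube c' (row_set d' i m) p.
    by move=> j; rewrite (row_set_lel cmd j) (row_set_le i m cd' j).
  have p2 : closed_cube p d' p.
    by move=> j; rewrite lexx (le_trans (row_set_le i m cd' j) (row_set_ler cmd j)).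
  have abp : closed_cube a b p.
    apply: (closed_cube_sub abc abd); apply: (closed_cube_sub cdc cdd).
    by move=> j; have := p1 j; have := p2 j; have := row_set_lel cmd j; lra.
  pose p' : X := exist _ p (mem_set abp).
  move=> x y /(closed_cube_halves i m)[x1|x2] /(closed_cube_halves i m)[y1|y2].
  + exact: P1.
  + by move=> /(P1 x p' x1 p1)/(P2 p' y p2 y2).
  + by move=> /(P2 x p' x2 p2)/(P1 p' y p1 y1).
  + exact: P2.
Qed.

(** The box is not a closed cube, but the coordinatewise minimum and maximum of two of its points
    span one inside it. *)
Lemma agree_thick c d e (s t : G (thick a b c d e)) (x y : X) :
  oset (thick a b c d e) x -> oset (thick a b c d e) y ->
  agree s t x -> agree s t y.
Proof.
move=> xe ye; pose p : 'rV[R]_n := \row_i Num.min ((pt x) 0 i) ((pt y) 0 i).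
pose q : 'rV[R]_n := \row_i Num.max ((pt x) 0 i) ((pt y) 0 i).
have abx := set_mem (valP x); have aby := set_mem (valP y).
have pqE i : [/\ p 0 i <= (pt x) 0 i, p 0 i <= (pt y) 0 i,
    (pt x) 0 i <= q 0 i & (pt y) 0 i <= q 0 i].
  by rewrite !mxE !ge_min !le_max !lexx !orbT.
have pI i : p 0 i = (pt x) 0 i \/ p 0 i = (pt y) 0 i.
  by rewrite mxE minElt; case: ifP; [left|right].
have qI i : q 0 i = (pt x) 0 i \/ q 0 i = (pt y) 0 i.
  by rewrite mxE maxElt; case: ifP; [right|left].
apply: (@agree_cube _ s t p q).
- by move=> i; case: (pI i) => ->; [exact: abx|exact: aby].
- by move=> i; case: (qI i) => ->; [exact: abx|exact: aby].
- by move=> i; have [] := pqE i; lra.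
- move=> z pqz i; have := xe i; have := ye i; have := pqz i.
  by case: (pI i) => ->; case: (qI i) => ->; lra.
- by move=> i; have [] := pqE i; lra.
- by move=> i; have [] := pqE i; lra.
Qed.

Lemma agree_thick_eq c d e (s t : G (thick a b c d e)) (x : X) :
  agree s t x -> s = t.
Proof.
move=> [xe st]; apply: value_ext => y ye.
have [ye' e'] : agree s t y by apply: (agree_thick xe ye); exists xe.
by rewrite (Prop_irrelevance ye ye').
Qed.

(** By bisection: extend [g] over the half containing [x], transport the value obtained at the
    corner [p] of the common face over the other half, then glue. *)
Lemma extend_value c d : closed_cube a b c -> closed_cube a b d -> row_le c d ->
  forall (x : X) (g : stalk F (f x)), closed_cube c d (pt x) ->
  exists2 e, 0 < e & exists s : G (thick a b c d e),
    forall xe : oset (thick a b c d e) x, value s xe = g.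
Proof.
move=> abc abd cd.
pose P c d := forall (x : X) (g : stalk F (f x)), closed_cube c d (pt x) ->
  exists2 e, 0 < e & exists s : G (thick a b c d e),
    forall xe : oset (thick a b c d e) x, value s xe = g.
apply: (@cube_bisection _ _ c d P) => //.
- move=> x cdx; pose x' : X := exist _ x (mem_set (closed_cube_sub abc abd cdx)).
  have [U [sg [Ux sg_surj _]]] := locally_constant_values f Fconst x'.
  have [e e0 eU] := open_thick Ux; exists e => // c' d' _ _ _ xc dx y g cdy.
  have [p pE] := sg_surj y (eU _ _ xc dx _ (closed_cube_thick e0 cdy)) g.
  exists e => //; exists (res G (eU _ _ xc dx) (sg p)) => ye.
  by rewrite (value_res _ _ _ (eU _ _ xc dx _ (closed_cube_thick e0 cdy))).
- move=> c' d' i m cdc cdd cd' cmd P1 P2.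
  pose p := row_set c' i m; pose q := row_set d' i m.
  have cp := row_set_lel cmd; have qd := row_set_ler cmd.
  have pq : row_le p q := row_set_le i m cd'.
  have p1 : closed_cube c' q p by move=> j; rewrite (cp j) (pq j).
  have p2 : closed_cube p d' p.
    by move=> j; rewrite lexx (le_trans (pq _) (qd _)).
  have abp : closed_cube a b p.
    apply: (closed_cube_sub abc abd); apply: (closed_cube_sub cdc cdd).
    by move=> j; have := p1 j; have := p2 j; have := cp j; lra.
  pose p' : X := exist _ p (mem_set abp).
  (* Agreement at [p'] suffices for gluing, because sections over the box of the common face are
     determined by one value. *)
  have glue e1 e2 (s1 : G (thick a b c' q e1)) (s2 : G (thick a b p d' e2)) :
      0 < e1 -> 0 < e2 ->
      (forall (h1 : oset (thick a b c' q e1) p') (h2 : oset (thick a b p d' e2) p'),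
        value s1 h1 = value s2 h2) ->
      exists2 e, 0 < e & exists s : G (thick a b c' d' e),
        forall (x : X) (xe : oset (thick a b c' d' e) x),
        (closed_cube c' q (pt x) -> forall x1, value s xe = @value _ _ _ _ s1 x x1) /\
        (closed_cube p d' (pt x) -> forall x2, value s xe = @value _ _ _ _ s2 x x2).
    move=> e10 e20 s12; pose e := Num.min e1 e2.
    have [e0 ee1 ee2] : [/\ 0 < e, e <= e1 & e <= e2].
      by rewrite lt_min e10 e20 !ge_min !lexx orbT.
    exists e => //.
    have l1 := thick_le (a := a) (b := b) (c := c') (d := q) ee1.
    have l2 := thick_le (a := a) (b := b) (c := p) (d := d') ee2.
    have h1 := thickS (a := a) (b := b) cp (fun j => lexx (q 0 j)) (lexx e).
    have h2 := thickS (a := a) (b := b) (fun j => lexx (p 0 j)) qd (lexx e).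
    have k1 := thickS (a := a) (b := b) (fun j => lexx (c' 0 j)) qd (lexx e).
    have k2 := thickS (a := a) (b := b) cp (fun j => lexx (d' 0 j)) (lexx e).
    have [|s [s1E s2E]] := @glue_halves _ _ a b c' d' i m G e
        (res G l1 s1) (res G l2 s2) h1 h2 k1 k2 e0.
      have pe : oset (thick a b p q e) p'.
        by apply: closed_cube_thick => //; exact: closed_cubel.
      apply: (@agree_thick_eq _ _ _ _ _ p'); exists pe.
      rewrite !(value_res _ _ _ (h1 _ pe), value_res _ _ _ (h2 _ pe)).
      by rewrite (value_res _ _ _ (l1 _ (h1 _ pe))) (value_res _ _ _ (l2 _ (h2 _ pe))).
    exists s => x xe.
    split=> [/(closed_cube_thick e0) xh x1|/(closed_cube_thick e0) xh x2].
      by rewrite -(value_res l1 s1 xh) -s1E (value_res _ _ _ xe).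
    by rewrite -(value_res l2 s2 xh) -s2E (value_res _ _ _ xe).
  move=> x g /(closed_cube_halves i m)[x1|x2].
  + have [e1 e10 [s1 s1E]] := P1 x g x1.
    have p1e := closed_cube_thick e10 (p1 : closed_cube c' q (pt p')).
    have [e2 e20 [s2 s2E]] := P2 p' (value s1 p1e) p2.
    have [|e e0 [s sE]] := glue _ _ s1 s2 e10 e20.
      by move=> h1 h2; rewrite s2E (Prop_irrelevance h1 p1e).
    exists e => //; exists s => xe.
    by rewrite ((sE x xe).1 x1 (closed_cube_thick e10 x1)) s1E.
  + have [e2 e20 [s2 s2E]] := P2 x g x2.
    have p2e := closed_cube_thick e20 (p2 : closed_cube p d' (pt p')).
    have [e1 e10 [s1 s1E]] := P1 p' (value s2 p2e) p1.
    have [|e e0 [s sE]] := glue _ _ s1 s2 e10 e20.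
      by move=> h1 h2; rewrite s1E (Prop_irrelevance h2 p2e).
    exists e => //; exists s => xe.
    by rewrite ((sE x xe).2 x2 (closed_cube_thick e20 x2)) s2E.
Qed.

End LocallyConstant.

(** * Cocycles near subcubes *)

Section Resolution.
Variables (R : realType) (n : nat) (a b : 'rV[R]_n).
Local Notation X := (set_type (closed_cube a b)).
Local Notation pt := (\val : X -> 'rV[R]_n).
Local Notation nbhd := (thick a b).
Implicit Types (c d : 'rV[R]_n) (e : R) (F G H : sheaf X).

(** First assertion of the induction on [p]; [t] prolongs [s] only after thinning the box to
    [e']. *)
Definition cocycles_extend G H (D : sheaf_hom G H) :=
  forall c d c' d' e (s : G (nbhd c d e)),
  closed_cube a b c' -> closed_cube a b d' -> row_le c' d' ->
  closed_cube c' d' c -> closed_cube c' d' d -> row_le c d ->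
  0 < e -> D _ s = 0 ->
  exists e' (t : G (nbhd c' d' e')), [/\ 0 < e', e' <= e, D _ t = 0 &
    forall (k : nbhd c d e' `<=` nbhd c' d' e') (l : nbhd c d e' `<=` nbhd c d e),
      res G k t = res G l s].

Definition cocycles_bound F G H (D : sheaf_hom F G) (D' : sheaf_hom G H) :=
  forall c d e (s : G (nbhd c d e)),
  closed_cube a b c -> closed_cube a b d -> row_le c d ->
  0 < e -> D' _ s = 0 ->
  exists e' (t : F (nbhd c d e')), [/\ 0 < e', e' <= e &
    forall (l : nbhd c d e' `<=` nbhd c d e), D _ t = res G l s].

(** Bisection: exactness gives primitives on small cubes, and the extension property for [D] lets
    primitives on two halves be glued. *)
Lemma cocycles_boundP F G H (D : sheaf_hom F G) (D' : sheaf_hom G H) :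
  exact_at D D' -> cocycles_extend D -> cocycles_bound D D'.
Proof.
move=> [_ ex] ext c d e s abc abd cd e0 s0.
pose P c' d' := exists e' (t : F (nbhd c' d' e')), [/\ 0 < e', e' <= e &
    forall (l : nbhd c' d' e' `<=` nbhd c d e), D _ t = res G l s].
apply: (@cube_bisection _ _ c d P) => //.
- move=> x cdx; pose x' : X := exist _ x (mem_set (closed_cube_sub abc abd cdx)).
  have [V [Vcd [t [Vx tE]]]] :=
    ex _ s s0 x' (closed_cube_thick e0 (cdx : closed_cube c d (pt x'))).
  have [e1 e10 eV] := open_thick Vx; exists (e1 / 2); first by lra.
  move=> c' d' _ _ _ xc dx.
  have xc1 i : x 0 i - e1 < c' 0 i - e1 / 2 by have := xc i; lra.
  have dx1 i : d' 0 i + e1 / 2 < x 0 i + e1 by have := dx i; lra.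
  pose e' := Num.min (e1 / 2) e.
  have [e'0 e'1 e'e] : [/\ 0 < e', e' <= e1 / 2 & e' <= e].
    by rewrite lt_min e0 !ge_min !lexx orbT; split=> //; rewrite andbT; lra.
  have sub : nbhd c' d' e' `<=` V.
    apply: (subset_trans _ (eV c' d' _ _)).
    + by apply: thick_le; lra.
    + by move=> i; have := xc i; rewrite /=; lra.
    + by move=> i; have := dx i; rewrite /=; lra.
  exists e', (res F sub t); split=> // l.
  by rewrite hom_nat tE res_trans; exact: res_irr.
- move=> c' d' i m cdc cdd cd' cmd [e1 [t1 [e10 e1e t1E]]] [e2 [t2 [e20 e2e t2E]]].
  pose p := row_set c' i m; pose q := row_set d' i m.
  have cp := row_set_lel cmd; have qd := row_set_ler cmd.
  have pq : row_le p q := row_set_le i m cd'.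
  have cq : row_le c' q by move=> j; rewrite (le_trans (cp j) (pq j)).
  have cc j : c' 0 j <= c' 0 j by [].
  have dd j : d' 0 j <= d' 0 j by [].
  have [pp qq] : row_le p p /\ row_le q q by split=> j.
  have cdq : closed_cube c d q.
    by move=> j; have := cdc j; have := cq j; have := qd j; have := cdd j; lra.
  pose e3 := Num.min e1 e2.
  have [e30 e31 e32] : [/\ 0 < e3, e3 <= e1 & e3 <= e2].
    by rewrite lt_min e10 e20 !ge_min !lexx orbT.
  have l1 : nbhd p q e3 `<=` nbhd c' q e1 by exact: thickS.
  have l2 : nbhd p q e3 `<=` nbhd p d' e2 by exact: thickS.
  have lpq : nbhd p q e3 `<=` nbhd c d e.
    apply: thickS; [|by move=> j; case/andP: (cdq j)|by rewrite (le_trans e31)].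
    by move=> j; have := cdc j; have := cp j; lra.
  have lcq : nbhd c' q e1 `<=` nbhd c d e.
    by apply: thickS => // j; [case/andP: (cdc j)|case/andP: (cdq j)].
  have lpd : nbhd p d' e2 `<=` nbhd c d e.
    apply: thickS => // j; last by case/andP: (cdd j).
    by have := cdc j; have := cp j; lra.
  (* On the box of the common face, the two primitives differ by a cocycle. *)
  have r0 : D _ (res F l1 t1 - res F l2 t2) = 0.
    rewrite raddfB !hom_nat (t1E lcq) (t2E lpd) !res_trans.
    by apply/eqP; rewrite subr_eq0; apply/eqP; exact: res_irr.
  have abc' := closed_cube_sub abc abd cdc.
  have abq := closed_cube_sub abc abd cdq.
  have cqp : closed_cube c' q p by move=> j; rewrite (cp j) (pq j).
  (* Extend this difference from the face to a cocycle [u] near the lower half. *)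
  have [e4 [u [e40 e43 u0 uE]]] :=
    ext p q c' q e3 _ abc' abq cq cqp (closed_cuber cq) pq e30 r0.
  have e41 : e4 <= e1 by lra.
  have e42 : e4 <= e2 by lra.
  have e4e : e4 <= e by lra.
  have h1 : nbhd p q e4 `<=` nbhd c' q e4 by exact: thickS.
  have h2 : nbhd p q e4 `<=` nbhd p d' e4 by exact: thickS.
  have h3 : nbhd p q e4 `<=` nbhd p q e3 by exact: thick_le.
  have k1 : nbhd c' q e4 `<=` nbhd c' d' e4 by exact: thickS.
  have k2 : nbhd p d' e4 `<=` nbhd c' d' e4 by exact: thickS.
  have m1 : nbhd c' q e4 `<=` nbhd c' q e1 by exact: thick_le.
  have m2 : nbhd p d' e4 `<=` nbhd p d' e2 by exact: thick_le.
  (* Subtracting [u] makes the first primitive agree with the second near the face; as [D] kills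
     [u], it remains a primitive. *)
  have [|t [tE1 tE2]] := @glue_halves _ _ a b c' d' i m F e4
      (res F m1 t1 - u) (res F m2 t2) h1 h2 k1 k2 e40.
    rewrite raddfB (uE h1 h3) raddfB !res_trans.
    rewrite (res_irr (subset_trans h1 m1) (subset_trans h3 l1)) subKr.
    exact: res_irr.
  exists e4, t; split=> // l; apply: sheaf_ext => x xe.
  have [x1|x2] := thick_halves i m e40 xe.
    exists (nbhd c' q e4), k1; split=> //.
    rewrite -hom_nat tE1 raddfB u0 subr0 hom_nat (t1E lcq) !res_trans.
    exact: res_irr.
  exists (nbhd p d' e4), k2; split=> //.
  by rewrite -hom_nat tE2 hom_nat (t2E lpd) !res_trans; exact: res_irr.
Qed.

(** Take a primitive near the small cube and extend it by flasqueness of [F]; its image under [D] is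
    a cocycle because [D'] after [D] is zero. *)
Lemma cocycles_bound_extend F G H (D : sheaf_hom F G) (D' : sheaf_hom G H) :
  injective_sheaf F -> exact_at D D' -> cocycles_bound D D' -> cocycles_extend D'.
Proof.
move=> Finj [DD _] bound c d c' d' e s abc' abd' cd' cdc cdd cd e0 s0.
have abc := closed_cube_sub abc' abd' cdc.
have abd := closed_cube_sub abc' abd' cdd.
have [e' [t [e'0 e'e tE]]] := bound c d e s abc abd cd e0 s0.
have k : nbhd c d e' `<=` nbhd c' d' e'.
  by apply: thickS => // j; [case/andP: (cdc j)|case/andP: (cdd j)].
have [u uE] := injective_flasque k t Finj.
exists e', (D _ u); split=> // k' l.
by rewrite -hom_nat (res_irr k' k) uE tE.
Qed.

(** A cocycle comes from a section [v] of the locally constant sheaf. Its value at the corner [c]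
    extends over the larger cube, and uniqueness from one value identifies the extension with [v]
    near the small one. *)
Lemma locally_constant_extend (Y : topologicalType) (f : continuousType X Y)
    (A : zmodType) (F : sheaf Y) G H (i : sheaf_hom (inverse_image f F) G)
    (D : sheaf_hom G H) :
  locally_constant_sheaf A F -> mono_hom i -> exact_at i D -> cocycles_extend D.
Proof.
move=> Fconst imono [iD ex] c d c' d' e s abc' abd' cd' cdc cdd cd e0 s0.
have [v vE] := mono_lift imono (ex _ s s0).
have abc := closed_cube_sub abc' abd' cdc.
pose x : X := exist _ c (mem_set abc).
have cdx : closed_cube c d (pt x) := closed_cubel cd.
have xe := closed_cube_thick e0 cdx.
have [e1 e10 [w wE]] :=
  extend_value Fconst abc' abd' cd' (value v xe) (cdc : closed_cube c' d' (pt x)).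
pose e' := Num.min e1 e.
have [e'0 e'1 e'e] : [/\ 0 < e', e' <= e1 & e' <= e].
  by rewrite lt_min e0 e10 !ge_min !lexx orbT.
have h : nbhd c' d' e' `<=` nbhd c' d' e1 by exact: thick_le.
exists e', (i _ (res _ h w)); split=> // k l.
rewrite -hom_nat -vE -hom_nat; congr (i _ _).
apply: (agree_thick_eq Fconst (x := x)); exists (closed_cube_thick e'0 cdx).
have kx := k _ (closed_cube_thick e'0 cdx).
by rewrite (value_res _ _ _ kx) (value_res _ _ _ (h _ kx)) (value_res _ _ _ xe) wE.
Qed.

(** Extension for [diff J p] yields primitives for cocycles of [diff J p.+1], and these yield
    extension for [diff J p.+1]. *)
Lemma resolution_cocycles_extend (Y : topologicalType) (f : continuousType X Y)
    (A : zmodType) (F : sheaf Y) (J : injective_resolution (inverse_image f F)) p :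
  locally_constant_sheaf A F -> cocycles_extend (diff J p).
Proof.
move=> Fconst; elim: p => [|p IH].
  exact: (locally_constant_extend Fconst (@aug_mono _ _ J) (aug_exact J)).
apply: (cocycles_bound_extend (@term_injective _ _ J p) (diff_exact J p)).
exact: cocycles_boundP (diff_exact J p) IH.
Qed.

End Resolution.

(** * Vanishing of the cohomology groups *)

Lemma quot_eq0 (V : zmodType) (I : zmodClosed V) (x : Quotient.quot I) :
  repr x \in I -> x = 0.
Proof.
move=> xI; rewrite -[x]reprK -[RHS](raddf0 (\pi_(Quotient.quot I))%qT).
by apply/eqP; rewrite -Quotient.idealrBE subr0.
Qed.

Lemma cohomology_eq0 (X : topologicalType) (F : sheaf X)
    (J : injective_resolution F) (p : nat) :
  (forall s : J p.+1 oT, diff J p.+1 oT s = 0 ->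
     exists t : J p oT, diff J p oT t = s) ->
  forall c : cohomology J p.+1, c = 0.
Proof.
move=> h c; apply: quot_eq0; apply/asboolP.
by have /eqP/h[t tE] := valP (repr c); exists t.
Qed.

Unset Implicit Arguments.

Theorem theorem3p7 (R : realType) (n : nat) (a b : 'rV[R]_n)
    (hab : forall i : 'I_n, a 0 i < b 0 i)
    (Omega : set 'rV[R]_n) (hOmega : closed_cube a b `<=` Omega°)
    (A : zmodType) (F : sheaf Omega) (hF : locally_constant_sheaf A F)
    (J : injective_resolution
           (restriction_sub (subset_trans hOmega (@interior_subset _ Omega)) F))
    (p : nat) (hp : (0 < p)%N) (c : cohomology J p) :
  c = 0.
Proof.
case: p hp c => // p _; apply: cohomology_eq0 => s s0.
have ab : row_le a b by move=> i; exact: ltW.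
have bound := cocycles_boundP (diff_exact J p)
  (resolution_cocycles_extend (J := J) (p := p) hF).
(* For the whole cube every box of positive thickness is the entire space, so the thickness 1 is
   arbitrary and decreasing it loses nothing. *)
have sub : thick a b a b 1 `<=` oT by [].
have [|e [t [e0 _ tE]]] := bound a b 1 (res (J p.+1) sub s) (closed_cubel ab)
  (closed_cuber ab) ab ltr01.
  by rewrite hom_nat s0 raddf0.
have cover e' : 0 < e' -> oT `<=` thick a b a b e'.
  by move=> e'0 x _; apply: closed_cube_thick => //; exact: set_mem (valP x).
exists (res (J p) (cover e e0) t).
have le1 : thick a b a b e `<=` thick a b a b 1.
  by move=> x _; exact: cover.
by rewrite hom_nat (tE le1) !res_trans res_id.
Qed.
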